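(* Let $(G,\cdot)$ be a finitely generated nilpotent group and let $A\subseteq G$ satisfy $d^*_l(A)>0$. Then for any left Følner sequence $F=(F_N)_{N\in\mathbb{N}}$ in $G$ there is some $B\subseteq G$ such that $\overline{d}_F(B)>0$ and $BB\subseteq AA^{-1}$.
   Context: A left Følner sequence in a group $G$ is a sequence $(F_N)_{N\in\mathbb{N}}$ of finite nonempty subsets of $G$ such that $\lim_{N\to\infty}\frac{|gF_N\Delta F_N|}{|F_N|}=0$ for all $g\in G$. For $E\subseteq G$, $\overline{d}_F(E)=\limsup_{N\to\infty}\frac{|E\cap F_N|}{|F_N|}$, and the left upper Banach density is $d^*_l(E)=\sup\{\overline{d}_F(E):F\text{ a left Følner sequence in }G\}$. $BB=\{bb':b,b'\in B\}$ and $AA^{-1}=\{aa'^{-1}:a,a'\in A\}$. *)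

(* Defs.v *)
From mathcomp Require Import all_boot all_order all_algebra finmap.
From mathcomp Require Import all_classical all_reals all_analysis.

Set Implicit Arguments.
Unset Strict Implicit.
Unset Printing Implicit Defensive.

Import Order.TTheory GRing.Theory Num.Theory.
Import numFieldNormedType.Exports.

Local Open Scope classical_set_scope.
Local Open Scope ring_scope.

Section GroupNotions.
Context {G : groupType}.
Implicit Types (A B S H : set G) (x y g : G).

Definition is_subgroup H : Prop := group_closed [in H].

Definition generated S : set G := smallest is_subgroup S.

Definition finitely_generated : Prop :=
  exists S : set G, finite_set S /\ generated S = setT.

Fixpoint lower_central n : set G :=
  if n is m.+1
  then generated [set [~ x, y]%g | x in lower_central m & y in [set: G]]
  else setT.

Definition nilpotent_group : Prop := exists n, lower_central n = [set 1%g].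

Definition translate g A : set G := [set (g * x)%g | x in A].

Definition mulset A B : set G := [set (x * y)%g | x in A & y in B].

Definition invset A : set G := [set (x^-1)%g | x in A].

(* Number of elements of a finite set; it is 0 on infinite sets. *)
Definition set_card A : nat := #|` fset_set A |.

End GroupNotions.

Arguments finitely_generated : clear implicits.
Arguments nilpotent_group : clear implicits.

Section Density.
Context (R : realType) (G : groupType).
Implicit Types (F : nat -> set G) (E : set G).

Definition left_folner F : Prop :=
  [/\ forall N, finite_set (F N),
      forall N, F N !=set0 &
      forall g, (fun N => (set_card (translate g (F N) `+` F N))%:R
                           / (set_card (F N))%:R : R) @ \oo --> (0 : R)].

Definition upper_density F E : \bar R :=
  limn_esup (fun N => ((set_card (E `&` F N))%:R / (set_card (F N))%:R : R)%:E).

(* With values in \bar R, this is -oo if G has no left Folner sequence. *)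
Definition left_upper_banach_density E : \bar R :=
  ereal_sup [set upper_density F E | F in left_folner].

End Density.

(* Main.v *)
Require Import Defs.
From mathcomp Require Import all_boot all_order all_algebra finmap.
From mathcomp Require Import all_classical all_reals all_analysis.
From mathcomp Require Import ring lra.

(** Since [b * b' = (b * t) * (b'^-1 * t)^-1], the inclusion of [B * B] in
    [A * A^-1] holds as soon as every finite part [P] of [B] has a [t] such
    that [P t] and [P^-1 t] both lie in [A].  Let [m] be an invariant mean
    with [m A > 0], obtained as an ultrafilter limit of the averages along a
    Folner sequence that witnesses the positive Banach density.  The mean over
    [t] of the indicator of [g t \in A /\ g^-1 t \in A] is
    [m (A `&` g^2 A)] by invariance.  So what is needed is a recurrence
    theorem for squares: [m (A `&` g^2 A)] must be bounded below on average
    along the given sequence [F].  The element [t] may depend on the finite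
    part of [B], and an ultrafilter on [G] then assembles [B].

    The recurrence ([square_returns_syndetic]) says that for some finite [K]
    and every [g], some [k] in [K] has [m (A `&` (k g)^2 A) >= (m A)^2 / 2].
    Let [N] be normal in [G], and let [c] and [d] be central modulo [N].  Then
    [c^-2 g^2 d^2] is congruent to [(c^-1 d g)^2] modulo [N].  So if [v]
    is almost [N]-invariant, a correlation of an average of translates of [v]
    by squares of such elements with its own translate by [g^2] is at most a
    correlation of [v] with its translate by [(k g)^2], up to a small error, for a [k] in a finite
    set which does not depend on [g].  Minimising the norm among these averages
    gives an almost invariant one, by the parallelogram argument of the mean
    ergodic theorem.  One may thus enlarge [N] to the group generated by [N]
    and the squares of the elements that are central modulo [N]
    ([reducible_central_squares]).  In a finitely generated nilpotent group
    finitely many such enlargements of the trivial group reach finite index: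
    this follows a central series with cyclic quotients ([nilpotent_ind]),
    by a pigeonhole argument at each stage ([covered_adjoin]).  Once [v] is
    almost invariant under a subgroup of finite index, every [g] in that
    subgroup satisfies [<v, g^2 v> ~ <v, v> >= (m v)^2].

    The recurrence is syndetic, hence visible along [F] ([syndetic_favg]):
    averaged over [g] in [F n], the correlation [m (A `&` g^2 A)] is bounded
    below for large [n].  Consequently the set [T n] of those [t] which are
    good for a fixed proportion of the [g] in [F n] has mean bounded below, and
    an intersectivity lemma ([intersectivity]) yields an ultrafilter on [G]
    which contains finite unions of sets [T n] with [n] as large as desired.
    The [g] for which ultrafilter-many [t] satisfy both memberships form [B]. *)

Set Implicit Arguments.
Unset Strict Implicit.
Unset Printing Implicit Defensive.
Import Order.TTheory GRing.Theory Num.Theory.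
Import numFieldNormedType.Exports.
Local Open Scope classical_set_scope.

(** * Congruence modulo a normal subgroup and squares of central elements *)

Section Groups.
Local Open Scope group_scope.
Context {G : groupType}.
Implicit Types (H K N S : set G) (x y g c : G).

Lemma is_subgroupP H :
  is_subgroup H <-> [/\ H 1, forall x y, H x -> H y -> H (x * y)
                           & forall x, H x -> H x^-1].
Proof.
split=> [sH | [H1 HM HV]].
  have [H1 _] := sH; have HV := group_closedV sH.
  have HM := group_closedM sH; split; first by move: H1; rewrite inE.
  - by move=> x y Hx Hy; have := HM x y; rewrite !inE; apply.
  - by move=> x Hx; have := HV x; rewrite !inE; apply.
split; first by rewrite inE.
by move=> x y; rewrite !inE => Hx Hy; apply: HM => //; apply: HV.
Qed.

Lemma subgroup1 H : is_subgroup H -> H 1.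
Proof. by case/is_subgroupP. Qed.
Lemma subgroupM H x y : is_subgroup H -> H x -> H y -> H (x * y).
Proof. by case/is_subgroupP=> _ HM _; apply: HM. Qed.
Lemma subgroupV H x : is_subgroup H -> H x -> H x^-1.
Proof. by case/is_subgroupP=> _ _; apply. Qed.
Lemma subgroupX H x n : is_subgroup H -> H x -> H (x ^+ n).
Proof.
move=> sH Hx; elim: n => [|n IHn]; first exact: subgroup1.
by rewrite expgS; apply: subgroupM.
Qed.

Lemma generated_subgroup S : is_subgroup (generated S).
Proof.
apply/is_subgroupP; split.
- by move=> K [sK _]; exact: subgroup1.
- by move=> x y Sx Sy K SK; apply: (subgroupM SK.1); [exact: Sx | exact: Sy].
- by move=> x Sx K SK; apply: (subgroupV SK.1); exact: Sx.
Qed.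

Lemma generated_incl S : S `<=` generated S.
Proof. by move=> x Sx K [_]; apply. Qed.

Lemma generated_min S H : is_subgroup H -> S `<=` H -> generated S `<=` H.
Proof. by move=> sH SH x; apply. Qed.

Definition normal_subgroup N :=
  is_subgroup N /\ (forall x g, N x -> N (x ^ g)).

Lemma commMgJ x y g : [~ x * y, g] = [~ x, g] ^ y * [~ y, g].
Proof. by rewrite /commg /conjg !gnorm. Qed.

Lemma commVgJ x g : [~ x^-1, g] = [~ x, g]^-1 ^ x^-1.
Proof. by rewrite /commg /conjg !gnorm. Qed.

Section Modulo.
Variable (N : set G).
Hypothesis nN : normal_subgroup N.

Definition eqmod x y := N (x^-1 * y).

Lemma eqmod_refl x : eqmod x x.
Proof. by rewrite /eqmod mulVg; apply: subgroup1 nN.1. Qed.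

Lemma eqmod_sym x y : eqmod x y -> eqmod y x.
Proof. by move=> /(subgroupV nN.1); rewrite /eqmod !gnorm. Qed.

Lemma eqmod_trans x y z : eqmod x y -> eqmod y z -> eqmod x z.
Proof. by move=> xy /(subgroupM nN.1 xy); rewrite /eqmod !gnorm. Qed.

Lemma eqmodM x x' y y' : eqmod x x' -> eqmod y y' -> eqmod (x * y) (x' * y').
Proof.
move=> /(nN.2 _ y) xx' yy'; have := subgroupM nN.1 xx' yy'.
by rewrite /eqmod /conjg !gnorm.
Qed.

Lemma eqmodMl x y y' : eqmod y y' -> eqmod (x * y) (x * y').
Proof. exact/eqmodM/eqmod_refl. Qed.

Lemma eqmodMr y x x' : eqmod x x' -> eqmod (x * y) (x' * y).
Proof. by move=> xx'; apply: eqmodM xx' _; apply: eqmod_refl. Qed.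

Lemma eqmodV x x' : eqmod x x' -> eqmod x^-1 x'^-1.
Proof.
move=> xx'; apply: eqmod_sym; rewrite /eqmod invgK.
have -> : x' / x = (x^-1 * x') ^ x^-1 by rewrite /conjg !gnorm.
exact: nN.2.
Qed.

(** The preimage in [G] of the centre of the quotient by [N]. *)
Definition central_mod c := forall g, N [~ c, g].

Lemma central_modP c : central_mod c <-> forall g, eqmod (g * c) (c * g).
Proof.
by split=> cN g; have := cN g; rewrite /eqmod /commg /conjg !gnorm.
Qed.

Lemma centralizer_mod_subgroup g : is_subgroup [set x | N [~ x, g]].
Proof.
apply/is_subgroupP; split=> /=.
- by rewrite comm1g; apply: subgroup1 nN.1.
- move=> x y Nx Ny; rewrite commMgJ; apply: subgroupM nN.1 _ Ny.
  exact: nN.2.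
- by move=> x Nx; rewrite commVgJ; apply: nN.2; apply: subgroupV nN.1 _.
Qed.

Lemma central_mod_subgroup : is_subgroup central_mod.
Proof.
apply/is_subgroupP; split=> [g | x y cx cy g | x cx g].
- exact: subgroup1 (centralizer_mod_subgroup g).
- exact: subgroupM (centralizer_mod_subgroup g) (cx g) (cy g).
- exact: subgroupV (centralizer_mod_subgroup g) (cx g).
Qed.

(** The squares of the elements of the abelian group [Z(G / N)] form a
    subgroup; this is its preimage in [G]. *)
Definition central_squares :=
  [set q | exists2 c, central_mod c & eqmod (c * c) q].

Lemma central_squares_sub : N `<=` central_squares.
Proof.
move=> n Nn; exists 1; first exact: subgroup1 central_mod_subgroup.
by rewrite /eqmod !gnorm.
Qed.

Lemma central_squares_sq c : central_mod c -> central_squares (c * c).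
Proof. by move=> cc; exists c => //; apply: eqmod_refl. Qed.

Lemma central_sqM c d : central_mod c -> eqmod (c * c * (d * d)) ((c * d) * (c * d)).
Proof.
move=> /central_modP cc; rewrite -!mulgA; apply: eqmodMl; rewrite !mulgA.
by apply: eqmodMr; apply: eqmod_sym.
Qed.

Lemma central_squares_normal : normal_subgroup central_squares.
Proof.
split.
  apply/is_subgroupP; split.
  - by apply: central_squares_sub; apply: subgroup1 nN.1.
  - move=> x y [c cc cx] [d cd dy]; exists (c * d).
      exact: subgroupM central_mod_subgroup cc cd.
    apply: eqmod_trans (eqmodM cx dy).
    exact: eqmod_sym (central_sqM _ cc).
  - move=> x [c cc cx]; exists c^-1; first exact: subgroupV central_mod_subgroup cc.
    by rewrite -invgM; apply: eqmodV.
move=> x g [c cc cx]; exists c => //.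
have /central_modP ccg := subgroupM central_mod_subgroup cc cc.
have : eqmod (g^-1 * (c * c * g)) (x ^ g).
  by rewrite conjgE; apply: eqmodMl; apply: eqmodMr.
apply: eqmod_trans.
by have := eqmodMl g^-1 (ccg g); rewrite mulKg.
Qed.

(** This is where squares matter.  With [q] and [q'] congruent to [c^2] and
    [d^2], take [k = c^-1 d]: everything but [g] is central modulo [N], so that
    [(k g)^2] is congruent to [c^-2 d^2 g^2].  As [k] does not depend on [g],
    finitely many pairs [q, q'] only call for finitely many [k]. *)
Lemma central_squares_shift q q' : central_squares q -> central_squares q' ->
  exists k, forall g, eqmod ((k * g) * (k * g)) (q^-1 * (g * g) * q').
Proof.
move=> [c cc cq] [d cd dq']; exists (c^-1 * d) => g.
have cV := subgroupV central_mod_subgroup cc.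
have ck := subgroupM central_mod_subgroup cV cd.
have /central_modP dd := subgroupM central_mod_subgroup cd cd.
apply: eqmod_trans (eqmod_sym (central_sqM g ck)) _.
apply: eqmod_trans (eqmodMr (g * g) (eqmod_sym (central_sqM d cV))) _.
rewrite -!mulgA.
apply: (@eqmod_trans _ (c^-1 * (c^-1 * (g * (g * (d * d)))))).
  do 2!apply: eqmodMl; have := eqmod_sym (dd (g * g)).
  by rewrite !mulgA.
rewrite !mulgA -invgM -!mulgA; apply: eqmodM; first exact: eqmodV.
by do 2!apply: eqmodMl.
Qed.

End Modulo.

Lemma trivial_normal : normal_subgroup [set 1].
Proof.
split; last by move=> x g /= ->; rewrite conj1g.
apply/is_subgroupP; split=> //= [x y -> ->|x ->]; by rewrite ?mulg1 ?invg1.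
Qed.

Lemma comm_normal H : is_subgroup H -> (forall x g, H x -> H [~ x, g]) ->
  normal_subgroup H.
Proof.
move=> sH HR; split=> // x g Hx.
by have := subgroupM sH Hx (HR x g Hx); rewrite commgEl mulVKg.
Qed.

(** * Finitely generated nilpotent groups as iterated cyclic central extensions *)

Lemma lower_central_comm n x g :
  lower_central n x -> lower_central n.+1 [~ x, g].
Proof. by move=> nx; apply: generated_incl; exists x => //; exists g. Qed.

Lemma lower_central_subgroup n : is_subgroup (@lower_central G n).
Proof.
case: n => [|n]; last exact: generated_subgroup.
by apply/is_subgroupP.
Qed.

Lemma lower_central_decr n : @lower_central G n.+1 `<=` lower_central n.
Proof.
elim: n => [//|n IHn].
apply: generated_min; first exact: generated_subgroup.
by move=> _ [x /IHn nx [g _ <-]]; apply: lower_central_comm.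
Qed.

Lemma lower_central_normal n : normal_subgroup (@lower_central G n).
Proof.
apply: comm_normal; first exact: lower_central_subgroup.
by move=> x g nx; exact: (lower_central_decr (lower_central_comm g nx)).
Qed.

(** Generators of the next quotient are the commutators [[~ y, s]] of generators
    [y] of the current one with generators [s] of the group.  Indeed, modulo
    the subgroup [D] generated by these commutators and the term after next,
    each [y] commutes with the generators of the group, hence with the whole
    group; so the current term, which is generated by the [y] and by elements
    that are central modulo [D], is central modulo [D]. *)
Lemma lower_central_fg (S : seq G) n : generated [set` S] = setT ->
  exists Y : seq G, {in Y, forall y, lower_central n y} /\
    lower_central n `<=` generated ([set` Y] `|` lower_central n.+1).
Proof.
move=> genS; elim: n => [|n [Y [Yn genY]]].
  exists S; split=> // x _; have : generated [set` S] x by rewrite genS.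
  apply: generated_min; first exact: generated_subgroup.
  by move=> s Ss; apply: generated_incl; left.
pose Y' := [seq [~ y, s] | y <- Y, s <- S].
have Y'n : {in Y', forall y, lower_central n.+1 y}.
  by move=> _ /allpairsP[[y s] /= [/Yn yn _ ->]]; apply: lower_central_comm.
exists Y'; split=> //.
set D := generated _.
have sD : is_subgroup D by exact: generated_subgroup.
have DR x : lower_central n.+2 x -> D x by move=> ?; apply: generated_incl; right.
have Dn : D `<=` lower_central n.+1.
  apply: generated_min; first exact: lower_central_subgroup.
  by move=> x [/Y'n //|]; apply: lower_central_decr.
have nD : normal_subgroup D.
  by apply: comm_normal => // x g /Dn xn; exact: (DR _ (lower_central_comm g xn)).
have YD y : y \in Y -> central_mod D y.
  move=> yY g; rewrite -invgR; apply: (subgroupV sD).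
  have : generated [set` S] g by rewrite genS.
  apply: generated_min (centralizer_mod_subgroup nD y) _ _ => s sS /=.
  rewrite -invgR; apply: (subgroupV sD); apply: generated_incl; left.
  by apply/allpairsP; exists (y, s).
have nDc : lower_central n `<=` central_mod D.
  apply: subset_trans genY _; apply: generated_min.
    exact: central_mod_subgroup.
  move=> x [/YD //|xn g]; exact: (DR _ (lower_central_comm g xn)).
apply: generated_min => // _ [x xn [g _ <-]]; exact: nDc.
Qed.

(** Each quotient of the lower central series is finitely generated, so the
    series can be refined, from the bottom up, by adjoining generators one at
    a time; each of them is central modulo the next term of the series. *)
Lemma nilpotent_ind (P : set G -> Prop) :
  finitely_generated G -> nilpotent_group G ->
  P [set 1] ->
  (forall H y, normal_subgroup H -> P H -> central_mod H y ->
     P (generated (y |` H))) ->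
  P setT.
Proof.
move=> [S0 [/finite_seqP[S ->] genS]] [c Gc1] P1 Pstep.
suff /(_ c (leqnn c)) : forall i, i <= c -> P (lower_central (c - i)).
  by rewrite subnn.
elim=> [_|i IHi ltic]; first by rewrite subn0 Gc1.
have := IHi (ltnW ltic); rewrite (_ : c - i = (c - i.+1).+1)%N; last first.
  by rewrite -subSn// subSS.
move: (c - i.+1)%N => n {i IHi ltic} Pn.
have [Y [Yn genY]] := lower_central_fg n genS.
have Yc y : y \in Y -> forall g, lower_central n.+1 [~ y, g].
  by move=> /Yn yn g; apply: lower_central_comm.
suff [K [nK PK YK nK1 Kn]] : exists K, [/\ normal_subgroup K, P K,
    [set` Y] `<=` K, lower_central n.+1 `<=` K & K `<=` lower_central n].
  suff -> : lower_central n = K by [].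
  apply/seteqP; split=> //; apply: subset_trans genY _.
  by apply: generated_min nK.1 _; rewrite subUset.
elim: Y Yn Yc {genY} => [|y Y IHY] Yn Yc.
  exists (lower_central n.+1); split=> //.
  - exact: lower_central_normal.
  - exact: lower_central_decr.
have [||K [nK PK YK nK1 Kn]] := IHY.
- by move=> z zY; apply: Yn; rewrite inE zY orbT.
- by move=> z zY; apply: Yc; rewrite inE zY orbT.
have Ky : y \in y :: Y by rewrite inE eqxx.
have genK : generated (y |` K) `<=` lower_central n.
  apply: generated_min; first exact: lower_central_subgroup.
  by move=> z [->|]; [apply: Yn | apply: Kn].
have subK : K `<=` generated (y |` K) by move=> z Kz; apply: generated_incl; right.
exists (generated (y |` K)); split=> //.
- apply: comm_normal; first exact: generated_subgroup.
  by move=> x g /genK xn; exact: (subK _ (nK1 _ (lower_central_comm g xn))).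
- by apply: Pstep => // g; apply: nK1; apply: Yc.
- move=> z /=; rewrite inE => /predU1P[->|zY]; last by apply: subK; apply: YK.
  by apply: generated_incl; left.
- by apply: subset_trans nK1 _.
Qed.

(** * Reaching finite index *)

(** The index of [N] in [H * N] is finite. *)
Definition covered H (T : seq G) N :=
  forall h, H h -> exists2 t, t \in T & eqmod N t h.

(** The commutators of the powers of [y] with a fixed [s] lie in [H], which
    meets finitely many cosets of [N].  If the powers with exponents [i < j]
    give the same coset, then [y ^+ (j - i)] commutes with [s] modulo [N].  The
    product of the exponents found for the various [s] suits them all. *)
Lemma covered_commX H (T : seq G) N y (S : seq G) :
  normal_subgroup H -> normal_subgroup N -> covered H T N ->
  central_mod H y ->
  exists m, (0 < m)%N /\ {in S, forall s, N [~ y ^+ m, s]}.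
Proof.
move=> nH nN cov cy; elim: S => [|s S [m [m0 mS]]]; first by exists 1%N.
suff [d [d0 ds]] : exists d, (0 < d)%N /\ N [~ y ^+ d, s].
  exists (m * d)%N; split; first by rewrite muln_gt0 m0.
  move=> z; rewrite inE => /predU1P[->|zS].
    rewrite mulnC expgnA.
    exact: (subgroupX m (centralizer_mod_subgroup nN s) ds).
  rewrite expgnA.
  exact: (subgroupX d (centralizer_mod_subgroup nN z) (mS z zS)).
have covj (j : 'I_(size T).+1) : exists i : 'I_(size T), eqmod N (nth 1 T i) [~ y ^+ j, s].
  have [|t tT tj] := cov [~ y ^+ j, s].
    exact: (subgroupX j (centralizer_mod_subgroup nH s) (cy s)).
  by move: tT; rewrite -index_mem => tT; exists (Ordinal tT); rewrite /= nth_index // -index_mem.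
have [f fP] := choice covj.
have : ~~ injectiveb f.
  by apply/injectiveP => /leq_card; rewrite !card_ord ltnn.
move=> /injectivePn[i [j ij fij]].
wlog lt_ij : i j ij fij / (i < j)%N.
  move=> W; have /orP[ltij|ltji] : (i < j)%N || (j < i)%N.
    by rewrite -neq_ltn; apply: contraNneq ij => /val_inj ->.
  - exact: (W i j).
  - by apply: (W j i) => //; rewrite eq_sym.
exists (j - i)%N; split; first by rewrite subn_gt0.
have := eqmod_trans nN (eqmod_sym nN (fP i)) _; rewrite fij => /(_ _ (fP j)).
have -> : y ^+ j = y ^+ (j - i) * y ^+ i by rewrite -expgnDr subnK // ltnW.
rewrite commMgJ /eqmod -conjgE.
by move=> /(nN.2 _ [~ y ^+ i, s]^-1) /(nN.2 _ (y ^+ i)^-1); rewrite !conjgK.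
Qed.

(** A power [y ^+ m] commutes modulo [N] with generators of [G], hence it is
    central modulo [N] and [y ^+ (2 * m)] is a central square.  So the powers of
    [y] fill finitely many cosets of [central_squares N]. *)
Lemma covered_adjoin H (T : seq G) N y :
  finitely_generated G ->
  normal_subgroup H -> normal_subgroup N -> covered H T N ->
  central_mod H y ->
  exists T', covered (generated (y |` H)) T' (central_squares N).
Proof.
move=> [_ [/finite_seqP[S ->] genS]] nH nN cov cy.
have [m [m0 mS]] := covered_commX S nH nN cov cy.
have cm : central_mod N (y ^+ m).
  move=> g; have : generated [set` S] g by rewrite genS.
  rewrite -invgR => Sg; apply: subgroupV nN.1 _; move: g Sg.
  apply: generated_min (centralizer_mod_subgroup nN _) _ => s sS /=.
  by rewrite -invgR; apply: subgroupV nN.1 _; apply: mS.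
pose Q := central_squares N; pose M := (m + m)%N.
have nQ : normal_subgroup Q by apply: central_squares_normal.
have QM : Q (y ^+ M) by rewrite /M expgnDr; apply: central_squares_sq.
have M0 : (0 < M)%N by rewrite addn_gt0 m0.
(* Natural exponents are enough: [y ^+ M] is trivial modulo [Q]. *)
pose E := [set g | exists i h, H h /\ eqmod Q (y ^+ i * h) g].
have EM x z : E x -> E z -> E (x * z).
  move=> [i [h [Hh ix]]] [j [k [Hk jz]]].
  exists (i + j)%N, (h ^ (y ^+ j) * k); split.
    by apply: subgroupM nH.1 _ Hk; apply: nH.2.
  have := eqmodM nQ ix jz.
  by rewrite expgnDr /conjg !gnorm.
have Eh h : H h -> E h.
  by move=> Hh; exists 0%N, h; split=> //; rewrite expg0 mul1g; apply: eqmod_refl.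
have Ey i : E (y ^+ i).
  exists i, 1; split; first exact: subgroup1 nH.1.
  by rewrite mulg1; apply: eqmod_refl.
have EQ q : Q q -> E q.
  move=> Qq; exists 0%N, 1; split; first exact: subgroup1 nH.1.
  by rewrite /eqmod !gnorm.
have EV x : E x -> E x^-1.
  move=> [i [h [Hh ix]]].
  have -> : x^-1 = ((y ^+ i * h)^-1 * x)^-1 * (h^-1 * (y ^+ (M.-1 * i) * (y ^+ M ^+ i)^-1)).
    rewrite -expgnA (_ : M * i = i + M.-1 * i)%N; last by rewrite -{1}(prednK M0) mulSn.
    by rewrite expgnDr !gnorm.
  apply: (EM _ _ _ (EM _ _ (Eh _ (subgroupV nH.1 Hh)) (EM _ _ (Ey _) _))).
    by apply/EQ/(subgroupV nQ.1).
  by apply/EQ/(subgroupV nQ.1)/(subgroupX _ nQ.1).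
have sE : is_subgroup E.
  by apply/is_subgroupP; split=> //; apply: Eh; apply: subgroup1 nH.1.
exists [seq y ^+ r * t | r <- iota 0 M, t <- T] => g gH.
have [i [h [Hh ig]]] : E g.
  move: g gH; apply: generated_min sE _ => z [->|/Eh//].
  by have := Ey 1%N; rewrite expg1.
have [t tT th] := cov h Hh.
exists (y ^+ (i %% M) * t).
  by apply/allpairsP; exists (i %% M, t); rewrite mem_iota ltn_pmod.
apply: (eqmod_trans nQ _ ig); apply: (eqmodM nQ _ _); last first.
  exact: central_squares_sub nN _ th.
rewrite {2}(divn_eq i M) addnC expgnDr /eqmod mulKg mulnC expgnA.
exact: subgroupX nQ.1 QM.
Qed.

End Groups.

(** * Invariant means and almost invariant averages *)

Section Means.
Local Open Scope ring_scope.
Context {R : realType} {G : groupType}.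
Implicit Types (f u v w h : G -> R) (g k q x : G) (N Q : set G).

Definition bfun f := exists M : R, forall x, `|f x| <= M.

Definition unit_valued f := forall x, 0 <= f x <= 1.

Definition ltranslate g f := fun x => f (g^-1 * x)%g.

Definition average (e : seq G) f :=
  fun x => (size e)%:R^-1 * \sum_(q <- e) ltranslate q f x.

Lemma unit_bfun f : unit_valued f -> bfun f.
Proof. by move=> f01; exists 1 => x; have /andP[f0 f1] := f01 x; rewrite ger0_norm. Qed.

Lemma bfun_cst (c : R) : bfun (fun=> c).
Proof. by exists `|c|. Qed.

Lemma bfunD f h : bfun f -> bfun h -> bfun (fun x => f x + h x).
Proof.
move=> [M fM] [M' hM']; exists (M + M') => x.
by rewrite (le_trans (ler_normD _ _))// lerD.
Qed.

Lemma bfunN f : bfun f -> bfun (fun x => - f x).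
Proof. by move=> [M fM]; exists M => x; rewrite normrN. Qed.

Lemma bfunM f h : bfun f -> bfun h -> bfun (fun x => f x * h x).
Proof.
by move=> [M fM] [M' hM']; exists (M * M') => x; rewrite normrM ler_pM.
Qed.

Lemma bfun_norm f : bfun f -> bfun (fun x => `|f x|).
Proof. by move=> [M fM]; exists M => x; rewrite normr_id. Qed.

Lemma bfun_shift g f : bfun f -> bfun (ltranslate g f).
Proof. by move=> [M fM]; exists M => x; apply: fM. Qed.

Lemma bfun_sum I (r : seq I) (F : I -> G -> R) :
  (forall i, bfun (F i)) -> bfun (fun x => \sum_(i <- r) F i x).
Proof.
move=> Fb; elim: r => [|i r IHr].
  by under eq_fun do rewrite big_nil; apply: bfun_cst.
by under eq_fun do rewrite big_cons; apply: bfunD.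
Qed.

Lemma bfun_average e f : bfun f -> bfun (average e f).
Proof.
move=> fb; apply: bfunM; first exact: bfun_cst.
by apply: bfun_sum => q; apply: bfun_shift.
Qed.

Lemma shiftM g k f : ltranslate g (ltranslate k f) = ltranslate (g * k)%g f.
Proof. by apply/funext => x; rewrite /ltranslate invgM mulgA. Qed.

Lemma shift1 f : ltranslate 1%g f = f.
Proof. by apply/funext => x; rewrite /ltranslate invg1 mul1g. Qed.

Lemma sum_const_seq (I : Type) (e : seq I) (a : R) :
  \sum_(q <- e) a = (size e)%:R * a.
Proof. by rewrite big_const_seq count_predT iter_addr_0 mulr_natl. Qed.

Lemma unit_average e f : (0 < size e)%N -> unit_valued f -> unit_valued (average e f).
Proof.
move=> e0 f01 x; have e0R : 0 < (size e)%:R :> R by rewrite ltr0n.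
rewrite /average mulr_ge0 ?invr_ge0 ?ler0n//=; last first.
  by apply: sumr_ge0 => q _; have /andP[] := f01 (q^-1 * x)%g.
rewrite mulrC ler_pdivrMr// mul1r.
rewrite -[X in _ <= X]mulr1 -sum_const_seq.
apply: ler_sum => q _; by have /andP[] := f01 (q^-1 * x)%g.
Qed.

Lemma mem_ge_average (I : eqType) (e : seq I) (F : I -> R) : (0 < size e)%N ->
  exists2 q : I, q \in e & (size e)%:R^-1 * \sum_(q <- e) F q <= F q.
Proof.
move=> e0; have e0R : 0 < (size e)%:R :> R by rewrite ltr0n.
apply: contrapT => noq.
set a := _ * _ in noq.
have lt_a (q : I) : q \in e -> F q < a.
  by move=> qe; rewrite ltNge; apply/negP => aF; apply: noq; exists q.
have : \sum_(q <- e) F q < \sum_(q <- e) a.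
  rewrite [X in X < _]big_seq [X in _ < X]big_seq; apply: ltr_sum => //.
  by case: e e0 {noq a e0R lt_a} => //= q e _; rewrite inE eqxx.
rewrite sum_const_seq /a mulrA divff ?mul1r ?ltxx//.
by rewrite gt_eqF.
Qed.

Definition invariant_mean (m : (G -> R) -> R) :=
  [/\ m (fun=> 1) = 1,
      forall f h, bfun f -> bfun h -> m (fun x => f x + h x) = m f + m h,
      forall c f, bfun f -> m (fun x => c * f x) = c * m f,
      forall f, bfun f -> (forall x, 0 <= f x) -> 0 <= m f &
      forall g f, bfun f -> m (ltranslate g f) = m f].

Section Mean.
Variable m : (G -> R) -> R.
Hypothesis mP : invariant_mean m.

Lemma mean_cst c : m (fun=> c) = c.
Proof.
case: mP => m1 _ mZ _ _.
by have := mZ c _ (bfun_cst 1); rewrite m1 mulr1.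
Qed.

Lemma meanD f h : bfun f -> bfun h -> m (fun x => f x + h x) = m f + m h.
Proof. by case: mP => _ + _ _ _; apply. Qed.

Lemma meanZ c f : bfun f -> m (fun x => c * f x) = c * m f.
Proof. by case: mP => _ _ + _ _; apply. Qed.

Lemma meanN f : bfun f -> m (fun x => - f x) = - m f.
Proof.
by move=> fb; under eq_fun do rewrite -mulN1r; rewrite meanZ// mulN1r.
Qed.

Lemma meanB f h : bfun f -> bfun h -> m (fun x => f x - h x) = m f - m h.
Proof. by move=> fb hb; rewrite meanD ?meanN//; apply: bfunN. Qed.

Lemma mean_shift g f : bfun f -> m (ltranslate g f) = m f.
Proof. by case: mP => _ _ _ _; apply. Qed.

Lemma mean_ge0 f : bfun f -> (forall x, 0 <= f x) -> 0 <= m f.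
Proof. by case: mP => _ _ _ + _; apply. Qed.

Lemma mean_le f h : bfun f -> bfun h -> (forall x, f x <= h x) -> m f <= m h.
Proof.
move=> fb hb fh; rewrite -subr_ge0 -meanB//; apply: mean_ge0.
  by apply/bfunD/bfunN.
by move=> x; rewrite subr_ge0.
Qed.

Lemma mean_sum I (r : seq I) (F : I -> G -> R) : (forall i, bfun (F i)) ->
  m (fun x => \sum_(i <- r) F i x) = \sum_(i <- r) m (F i).
Proof.
move=> Fb; elim: r => [|i r IHr].
  by under eq_fun do rewrite big_nil; rewrite big_nil mean_cst.
under eq_fun do rewrite big_cons.
by rewrite big_cons meanD ?IHr//; apply: bfun_sum.
Qed.

(** A substitute for the Cauchy-Schwarz inequality that avoids square roots:
    it integrates [2 * e * `|h| <= e ^+ 2 + h ^+ 2]. *)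
Lemma mean_norm_le e h : bfun h -> 0 < e -> m (fun x => h x ^+ 2) <= e ^+ 2 ->
  m (fun x => `|h x|) <= e.
Proof.
move=> hb e0 he.
have hb2 : bfun (fun x => h x ^+ 2) by apply: bfunM.
apply: (@le_trans _ _ (m (fun x => (2 * e)^-1 * (e ^+ 2 + h x ^+ 2)))).
  apply: mean_le; first exact: bfun_norm.
    by apply: bfunM; [apply: bfun_cst | apply: bfunD => //; apply: bfun_cst].
  move=> x; rewrite mulrC ler_pdivlMr ?mulr_gt0// -(real_normK (num_real (h x))).
  have : 0 <= (`|h x| - e) ^+ 2 by apply: sqr_ge0.
  by move: `|h x| => y; nra.
rewrite meanZ; last by apply: bfunD => //; apply: bfun_cst.
rewrite meanD ?mean_cst//; last exact: bfun_cst.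
by rewrite mulrC ler_pdivrMr ?mulr_gt0//; nra.
Qed.

(** The semi-inner product of the Hilbert space of the mean. *)
Definition ip u w := m (fun x => u x * w x).

Lemma ipC u w : ip u w = ip w u.
Proof. by rewrite /ip; under eq_fun do rewrite mulrC. Qed.

Lemma ip_shift g k u w : bfun u -> bfun w ->
  ip (ltranslate g u) (ltranslate k w) = ip u (ltranslate (g^-1 * k)%g w).
Proof.
move=> ub wb; rewrite /ip.
rewrite -[RHS](mean_shift g); last by apply: bfunM => //; apply: bfun_shift.
by congr m; apply/funext => x; rewrite /ltranslate invgM invgK -mulgA mulVKg.
Qed.

Lemma ip_le_norm u v w : unit_valued u -> bfun v -> bfun w ->
  ip u v <= ip u w + m (fun x => `|v x - w x|).
Proof.
move=> u01 vb wb; have ub := unit_bfun u01.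
rewrite /ip -meanD; last 2 first.
- exact: bfunM.
- by apply/bfun_norm/bfunD/bfunN.
apply: mean_le; first exact: bfunM.
  by apply: bfunD; [apply: bfunM | apply/bfun_norm/bfunD/bfunN].
move=> x; rewrite -lerBlDl -mulrBr (le_trans (ler_norm _))// normrM ler_piMl//.
by have /andP[u0 u1] := u01 x; rewrite ger0_norm.
Qed.

Lemma ip_average_le e v h : (0 < size e)%N -> bfun v -> bfun h ->
  exists2 q, q \in e & ip (average e v) h <= ip (ltranslate q v) h.
Proof.
move=> e0 vb hb.
have [q qe le_q] := mem_ge_average (fun q => ip (ltranslate q v) h) e0.
exists q => //; apply: le_trans le_q.
rewrite /ip /average; under eq_fun do rewrite -mulrA mulr_suml.
rewrite meanZ; last first.
  by apply: bfun_sum => p; apply: bfunM => //; apply: bfun_shift.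
by rewrite mean_sum// => p; apply: bfunM => //; apply: bfun_shift.
Qed.

Lemma average_midpoint q e v x :
  average (e ++ [seq (q * p)%g | p <- e]) v x =
  2^-1 * (average e v x + ltranslate q (average e v) x).
Proof.
have shiftq p : ltranslate (q * p)%g v x = ltranslate p v (q^-1 * x)%g.
  by rewrite /ltranslate invgM mulgA.
rewrite /average size_cat size_map addnn -muln2 natrM invfM.
rewrite big_cat big_map /= (eq_bigr _ (fun p _ => shiftq p)) [ltranslate q _ _]/ltranslate.
by ring.
Qed.

(** The quantitative heart of von Neumann's mean ergodic theorem: if the norm
    of [w] is almost minimal among the averages of translates of [v] by [Q],
    then, the midpoint of [w] and its [q]-translate being such an average, the
    parallelogram law bounds the distance between [w] and its translate. *)
Lemma almost_invariant_average Q v (e : R) : is_subgroup Q -> unit_valued v ->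
  0 < e -> exists r : seq G, [/\ (0 < size r)%N, {in r, forall q, Q q} &
    forall q, Q q ->
      m (fun x => `|average r v x - ltranslate q (average r v) x|) <= e].
Proof.
move=> sQ v01 e0; have vb := unit_bfun v01.
pose admissible (r : seq G) := (0 < size r)%N /\ {in r, forall q, Q q}.
pose E := [set ip (average r v) (average r v) | r in admissible].
have ab r : bfun (average r v) by apply: bfun_average.
have E0 r : 0 <= ip (average r v) (average r v).
  by apply: mean_ge0 => [|x]; [apply: bfunM | rewrite -expr2 sqr_ge0].
have infE : has_inf E.
  split; last by exists 0 => _ [r _ <-].
  exists (ip (average [:: 1%g] v) (average [:: 1%g] v)), [:: 1%g] => //.
  by split=> // q; rewrite inE => /eqP->; apply: subgroup1.
have e4 : 0 < e ^+ 2 / 4 by rewrite divr_gt0 ?exprn_gt0.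
have [_ [r [r0 rQ] <-] ltr] := inf_adherent e4 infE.
exists r; split=> // q Qq; set w := average r v.
have wb : bfun w by apply: ab.
have qwb : bfun (ltranslate q w) by apply: bfun_shift.
apply: mean_norm_le => //; first by apply/bfunD/bfunN.
pose r' := r ++ [seq (q * p)%g | p <- r].
have adm : admissible r'.
  split; first by rewrite size_cat addn_gt0 r0.
  move=> p; rewrite mem_cat => /orP[/rQ//|/mapP[p' /rQ Qp' ->]].
  exact: subgroupM.
have le_inf : inf E <= ip (average r' v) (average r' v).
  by apply: ge_inf; [exact: infE.2 | exists r'].
have -> : (fun x => (w x - ltranslate q w x) ^+ 2) = fun x =>
    2 * (w x * w x) + (2 * (ltranslate q w x * ltranslate q w x) -
    4 * (average r' v x * average r' v x)).
  by apply/funext => x; rewrite average_midpoint -/w; field.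
have b1 : bfun (fun x => w x * w x) by apply: bfunM.
have b2 : bfun (fun x => ltranslate q w x * ltranslate q w x) by apply: bfunM.
have b3 : bfun (fun x => average r' v x * average r' v x) by apply: bfunM.
have c1 c h : bfun h -> bfun (fun x => c * h x) by apply: bfunM; apply: bfun_cst.
rewrite meanD ?meanB ?meanZ//; try exact: c1; last by apply/bfunD/bfunN; apply: c1.
rewrite -!/(ip _ _) ip_shift// mulVg shift1.
by move: ltr le_inf; rewrite -/w; set a := ip w w; set b := ip _ _; lra.
Qed.

(** Lower bounds on the correlations of [f] with its translates by squares
    follow from lower bounds on those of functions with the same mean that are
    invariant under [N], up to an arbitrarily small error and a left
    translation of the square root by a finite set. *)
Definition reducible f N := forall e : R, 0 < e -> exists v (K : seq G),
  [/\ unit_valued v, m v = m f,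
      forall n, N n -> m (fun x => `|ltranslate n v x - v x|) <= e &
      forall g, exists2 k, k \in K &
        ip v (ltranslate (g * g)%g v) <=
        ip f (ltranslate ((k * g) * (k * g))%g f) + e].

Lemma reducible1 f : unit_valued f -> reducible f [set 1%g].
Proof.
move=> f01 e e0; exists f, [:: 1%g]; split=> //.
  move=> _ ->; rewrite shift1; under eq_fun do rewrite subrr normr0.
  by rewrite mean_cst ltW.
by move=> g; exists 1%g; rewrite ?inE// !mul1g lerDl ltW.
Qed.

Lemma mean_average r v : (0 < size r)%N -> bfun v -> m (average r v) = m v.
Proof.
move=> r0 vb; rewrite /average meanZ; last first.
  by apply: bfun_sum => q; apply: bfun_shift.
rewrite mean_sum; last by move=> q; apply: bfun_shift.
under eq_bigr do rewrite mean_shift//.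
by rewrite sum_const_seq mulrA mulVf ?mul1r// pnatr_eq0 -lt0n.
Qed.

Lemma ip_perturb v g n e : unit_valued v ->
  m (fun x => `|ltranslate n v x - v x|) <= e ->
  ip v (ltranslate (g * n)%g v) <= ip v (ltranslate g v) + e.
Proof.
move=> v01 ne; have vb := unit_bfun v01; have nb := bfun_shift n vb.
rewrite -shiftM (le_trans (ip_le_norm v01 (bfun_shift g nb) (bfun_shift g vb)))//.
rewrite lerD2l; apply: le_trans ne.
rewrite -(mean_shift g (f := fun x => `|ltranslate n v x - v x|))//.
by apply/bfun_norm/bfunD/bfunN.
Qed.

(** The almost invariant average [w] over [central_squares N] replaces [v].
    Expanding [w] on both sides of [<w, g^2 w>], some pair [q, q'] of its translations
    does at least as well as the average, and there [central_squares_shift]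
    trades the translations for a translation of [g], at the cost of an element
    of [N] under which [v] is almost invariant. *)
Lemma reducible_central_squares f N : normal_subgroup N ->
  reducible f N -> reducible f (central_squares N).
Proof.
move=> nN red e e0.
have e20 : 0 < e / 2 by rewrite divr_gt0.
have [v [K [v01 mv vN vK]]] := red _ e20.
have vb := unit_bfun v01; have nQ := central_squares_normal nN.
have [r [r0 rQ wQ]] := almost_invariant_average nQ.1 v01 e0.
set w := average r v in wQ; have wb : bfun w by apply: bfun_average.
have /choice[c cP] (p : G * G) : exists k, central_squares N p.1 ->
    central_squares N p.2 -> forall g,
    eqmod N ((k * g) * (k * g))%g (p.1^-1 * (g * g) * p.2)%g.
  have [[Q1 Q2]|nQ12] := pselect (central_squares N p.1 /\ central_squares N p.2).
    by have [k kP] := central_squares_shift nN Q1 Q2; exists k.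
  by exists 1%g => Q1 Q2; case: nQ12.
exists w, [seq (k * p)%g | k <- K, p <- [seq c (q, q') | q <- r, q' <- r]]; split.
- exact: unit_average.
- by rewrite mean_average.
- by move=> n Qn; under eq_fun do rewrite distrC; apply: wQ.
move=> g.
have [q qr le1] := ip_average_le r0 vb (bfun_shift (g * g)%g wb).
have [q' q'r le2] := ip_average_le r0 vb (bfun_shift (q^-1 * (g * g))^-1%g vb).
have cqq := cP (q, q') (rQ _ qr) (rQ _ q'r) g.
have [k kK le3] := vK (c (q, q') * g)%g.
exists (k * c (q, q'))%g.
  by apply/allpairsP; exists (k, c (q, q')); split=> //; apply/allpairsP; exists (q, q').
set a := (q^-1 * (g * g))%g in le2 cqq; set l := (c (q, q') * g)%g in cqq le3.
apply: (le_trans le1); rewrite ip_shift// -/a ipC -[X in ip _ X]shift1.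
rewrite ip_shift// mulg1; apply: (le_trans le2).
rewrite ipC ip_shift// invgK.
rewrite (_ : a * q' = l * l * ((l * l)^-1 * (a * q')))%g; last by rewrite mulVKg.
rewrite (le_trans (ip_perturb _ v01 (vN _ cqq)))//.
by move: le3; rewrite -!mulgA /l; lra.
Qed.

(** Translating [g] into [N] by one of finitely many representatives, the
    almost [N]-invariance of [v] gives [<v, g^2 v> >= <v, v> - e], and
    [<v, v> >= (m v)^2].  The choice [e = (m f)^2 / 4] leaves room for two
    errors. *)
Lemma square_returns_syndetic f N (T : seq G) : unit_valued f -> 0 < m f ->
  normal_subgroup N -> reducible f N -> covered setT T N ->
  exists K : seq G, forall g, exists2 k, k \in K &
    m f ^+ 2 / 2 <= ip f (ltranslate ((k * g) * (k * g))%g f).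
Proof.
move=> f01 mf0 nN red cov.
have e0 : 0 < m f ^+ 2 / 4 by rewrite divr_gt0 ?exprn_gt0.
have [v [K [v01 mv vN vK]]] := red _ e0.
have vb := unit_bfun v01.
(* This is the nonnegativity of the variance of [v]. *)
have norm_v : m f ^+ 2 <= ip v v.
  have : 0 <= m (fun x => (v x * v x) + ((- (2 * m f)) * v x + m f ^+ 2)).
    apply: mean_ge0 => [|x]; last first.
      by have := sqr_ge0 (v x - m f); congr (_ <= _); ring.
    apply: bfunD; first exact: bfunM.
    by apply: bfunD; [apply: bfunM => //|]; apply: bfun_cst.
  rewrite meanD ?meanD ?meanZ ?mean_cst ?mv//; try exact: bfun_cst.
  - by rewrite -/(ip v v) => ?; nra.
  - by apply: bfunM => //; apply: bfun_cst.
  - exact: bfunM.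
  - by apply: bfunD; [apply: bfunM => //|]; apply: bfun_cst.
exists [seq (k * t^-1)%g | k <- K, t <- T] => g.
have [t tT Ng] := cov g I; set h := (t^-1 * g)%g in Ng.
have [k kK le1] := vK h.
exists (k * t^-1)%g; first by apply/allpairsP; exists (k, t).
rewrite -[(k * t^-1 * g)%g]mulgA -/h.
have := ip_le_norm v01 vb (bfun_shift (h * h)%g vb).
have := vN _ (subgroupM nN.1 Ng Ng); under eq_fun do rewrite distrC.
by move: le1 norm_v; rewrite expr2; lra.
Qed.

End Mean.
End Means.

(** * Averages along a Folner sequence and the mean that they define *)

Section Folner.
Local Open Scope ring_scope.
Context {R : realType} {G : groupType}.
Implicit Types (f u v w h : G -> R) (g k q x : G) (F : nat -> set G) (A B C : set G).

Definition favg C f := (set_card C)%:R^-1 * \sum_(x <- fset_set C) f x.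

Lemma set_card_gt0 C : finite_set C -> C !=set0 -> (0 < set_card C)%N.
Proof.
move=> finC [x Cx]; rewrite cardfs_gt0; apply/fset0Pn; exists x.
by rewrite in_fset_set// inE.
Qed.

Lemma favg_le C f h : (forall x, C x -> f x <= h x) -> favg C f <= favg C h.
Proof.
move=> fh; have [finC|infC] := pselect (finite_set C).
  rewrite /favg ler_wpM2l ?invr_ge0// big_seq [X in _ <= X]big_seq.
  apply: ler_sum => x; rewrite in_fset_set// inE; exact: fh.
by rewrite /favg /fset_set; case: pselect => // ?; rewrite !big_seq_fset0.
Qed.

Lemma favgD C f h : favg C (fun x => f x + h x) = favg C f + favg C h.
Proof. by rewrite /favg big_split/= mulrDr. Qed.

Lemma favgZ C c f : favg C (fun x => c * f x) = c * favg C f.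
Proof. by rewrite /favg -mulr_sumr mulrCA. Qed.

Lemma favg_sum C I (r : seq I) (H : I -> G -> R) :
  favg C (fun x => \sum_(i <- r) H i x) = \sum_(i <- r) favg C (H i).
Proof. by rewrite /favg exchange_big/= mulr_sumr. Qed.

Lemma favg_cst C c : finite_set C -> C !=set0 -> favg C (fun=> c) = c.
Proof.
move=> finC C0; rewrite /favg sum_const_seq mulrA mulVf ?mul1r//.
by rewrite pnatr_eq0 -lt0n set_card_gt0.
Qed.

Lemma favg_indic C B : finite_set C ->
  favg C (\1_B) = (set_card (B `&` C))%:R / (set_card C)%:R.
Proof.
move=> finC; rewrite /favg mulrC; congr (_ / _).
have finBC : finite_set (B `&` C) by apply: finite_setIr.
rewrite -[RHS]mulr1 -sum_const_seq.
have -> : fset_set (B `&` C) = [fset x in fset_set C | x \in B]%fset.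
  apply/fsetP => x; rewrite in_fset_set// !inE/= in_fset_set//.
  by rewrite in_setI andbC.
rewrite big_fset/= [RHS]big_mkcond/=; apply: eq_bigr => x _.
by rewrite indicE; case: (x \in B).
Qed.

Lemma norm_favg C f M : finite_set C -> C !=set0 -> (forall x, `|f x| <= M) ->
  `|favg C f| <= M.
Proof.
move=> finC C0 fM; rewrite ler_norml; apply/andP; split.
  rewrite -(favg_cst (- M) finC C0); apply: favg_le => x _.
  by have := fM x; rewrite ler_norml => /andP[].
rewrite -(favg_cst M finC C0); apply: favg_le => x _.
by have := fM x; rewrite ler_norml => /andP[].
Qed.

Lemma norm_sumB_le C B f M : finite_set C -> finite_set B -> (forall x, `|f x| <= M) ->
  `|\sum_(x <- fset_set C) f x - \sum_(x <- fset_set B) f x|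
    <= M * (set_card (C `+` B))%:R.
Proof.
move=> finC finB fM.
have split_sum D E : finite_set D -> finite_set E ->
    \sum_(x <- fset_set D) f x =
    \sum_(x <- fset_set (D `&` E)) f x + \sum_(x <- fset_set (D `\` E)) f x.
  move=> finD finE; rewrite -!fsbig_finite//; last 2 first.
  - exact: finite_setD.
  - exact: finite_setIl.
  by rewrite (fsbigID E) ?setDE.
rewrite (split_sum C B)// (split_sum B C)// [B `&` C]setIC.
have finCB := finite_setD B finC; have finBC := finite_setD C finB.
have bound D : finite_set D -> `|\sum_(x <- fset_set D) f x| <= M * (set_card D)%:R.
  move=> finD; rewrite (le_trans (ler_norm_sum _ _ _))// mulrC -sum_const_seq.
  exact: ler_sum.
have -> : set_card (C `+` B) = (set_card (C `\` B) + set_card (B `\` C))%N.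
  rewrite /set_card /setY fset_setU// cardfsU -fset_setI//.
  rewrite (_ : _ `&` _ = set0) ?fset_set0 ?cardfs0 ?subn0//.
  by apply/seteqP; split => // x [[? ?] []].
rewrite opprD addrACA subrr add0r (le_trans (ler_normB _ _))// natrD mulrDr lerD//; exact: bound.
Qed.

Lemma favg_shift_cvg F g f : left_folner R F -> bfun f ->
  (fun n => favg (F n) (ltranslate g f) - favg (F n) f) @ \oo --> (0 : R).
Proof.
move=> [finF F0 folF] [M fM].
have M0 : 0 <= M by apply: le_trans (fM 1%g).
have lim0 : (fun n => M * ((set_card (translate g^-1%g (F n) `+` F n))%:R
    / (set_card (F n))%:R)) @ \oo --> (0 : R).
  by rewrite -(mulr0 M); apply: cvgMr; apply: folF.
apply: norm_cvg0; apply: squeeze_cvgr (cvg_cst (0 : R)) lim0.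
near=> n; rewrite normr_ge0 /= /favg -mulrBr normrM ger0_norm ?invr_ge0//.
rewrite mulrC mulrA ler_wpM2r ?invr_ge0//.
have -> : \sum_(x <- fset_set (F n)) ltranslate g f x =
    \sum_(x <- fset_set (translate g^-1%g (F n))) f x.
  rewrite -!fsbig_finite//; last exact: finite_image.
  by rewrite /translate fsbig_image// => x y _ _; apply: mulgI.
by apply: norm_sumB_le => //; apply: finite_image.
Unshelve. all: by end_near. Qed.

Lemma upper_density_gt0P F B : (0 < upper_density R F B)%E ->
  exists2 r : R, 0 < r & forall n0, exists2 n, (n0 <= n)%N &
    r < (set_card (B `&` F n))%:R / (set_card (F n))%:R.
Proof.
move=> d0; set d := upper_density R F B in d0.
have [r r0 rd] : exists2 r : R, 0 < r & (r%:E < d)%E.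
  case: d d0 => [s| |]//.
    by rewrite lte_fin => s0; exists (s / 2); [rewrite divr_gt0 | rewrite lte_fin; lra].
  by move=> _; exists 1; rewrite ?ltry.
exists r => // n0.
have /ereal_sup_gtP[_ [n n0n <-]] : (r%:E < ereal_sup
   ((fun N => ((set_card (B `&` F N))%:R / (set_card (F N))%:R : R)%:E)
     @` [set n | (n0 <= n)%N]))%E.
  apply: lt_le_trans rd _; apply: ereal_inf_lbound.
  by exists [set n | (n0 <= n)%N] => //; exact: nbhs_infty_ge.
by rewrite lte_fin; exists n.
Qed.

Lemma le_upper_density F B (r : R) :
  (forall n0, exists2 n, (n0 <= n)%N &
    r <= (set_card (B `&` F n))%:R / (set_card (F n))%:R) ->
  (r%:E <= upper_density R F B)%E.
Proof.
move=> freq; apply: le_ereal_inf_tmp => _ [V [n0 _ n0V] <-].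
have [n n0n rn] := freq n0.
apply: (@le_trans _ _ ((set_card (B `&` F n))%:R / (set_card (F n))%:R)%:E).
  by rewrite lee_fin.
by apply: ereal_sup_ubound; exists n => //; apply: n0V.
Qed.

Lemma ultra_fmap (T V : Type) (p : T -> V) (U : set_system T) :
  UltraFilter U -> UltraFilter (p @ U).
Proof.
move=> ultraU; split=> [|W properW subW].
  exact: fmap_proper_filter.
apply/seteqP; split=> [D WD|]; last exact: subW.
have [//|UnD] := in_ultra_setVsetC (p @^-1` D) ultraU.
have : W (D `&` ~` D) by apply: filterI => //; apply: subW.
by rewrite setICr => /filter_not_empty.
Qed.

(** The ultrafilter contains the indices at which the density of [A] exceeds a
    fixed positive number, and it refines the filter at infinity, so that the
    Folner condition makes the limit of the averages invariant. *)
Lemma folner_mean F A : left_folner R F -> (0 < upper_density R F A)%E ->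
  exists2 m, invariant_mean m & 0 < m (\1_A : G -> R).
Proof.
move=> folF /upper_density_gt0P[r r0 freq]; have [finF F0 _] := folF.
pose I := [set n | r < (set_card (A `&` F n))%:R / (set_card (F n))%:R :> R].
have properI : ProperFilter (within I \oo).
  split; last exact: within_filter.
  move=> [n0 _ n0V]; have [n n0n rn] := freq n0; exact: (n0V n n0n rn).
have [U [ultraU subU]] := ultraFilterLemma properI.
have UI : U I by apply: subU; apply: withinT.
have Uoo V : \oo V -> U V.
  by move=> ooV; apply: subU; apply: filterS ooV.
pose u f n := favg (F n) f.
have cvgU f : bfun f -> cvg (u f @ U).
  move=> [M fM]; have M0 : 0 <= M by apply: le_trans (fM 1%g).
  have : compact `[(- M), M] by exact: segment_compact.
  rewrite compact_ultra => /(_ (u f @ U) (ultra_fmap _ ultraU)) [].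
    by apply: (@filterE _ U) => n; rewrite /= in_itv/= -ler_norml; apply: norm_favg.
  by move=> l [_ ul]; apply/cvg_ex; exists l.
have lim_eq f (l : R) : u f @ U --> l -> lim (u f @ U) = l.
  exact: cvg_lim.
exists (fun f => lim (u f @ U)); last first.
  have bA : bfun (\1_A : G -> R).
    by exists 1 => x; rewrite indicE; case: (x \in A); rewrite ?normr1 ?normr0.
  apply: (lt_le_trans r0); apply: limr_ge; first exact: cvgU.
  by apply: filterS UI => n; rewrite /u favg_indic// => /ltW.
split.
- apply: lim_eq; rewrite (_ : u _ = fun=> 1); first exact: cvg_cst.
  by apply/funext => n; apply: favg_cst.
- move=> f h fb hb; apply: lim_eq.
  rewrite (_ : u _ = fun n => u f n + u h n).
    by apply: cvgD; apply: cvgU.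
  by apply/funext => n; apply: favgD.
- move=> c f fb; apply: lim_eq.
  rewrite (_ : u _ = fun n => c * u f n).
    by apply: cvgMr; apply: cvgU.
  by apply/funext => n; apply: favgZ.
- move=> f fb f0; apply: limr_ge; first exact: cvgU.
  apply: filterE => n; rewrite -(favg_cst 0 (finF n) (F0 n)).
  exact: favg_le.
move=> g f fb; apply: lim_eq.
rewrite (_ : u _ = fun n => (u (ltranslate g f) n - u f n) + u f n); last first.
  by apply/funext => n; rewrite subrK.
rewrite -[X in _ --> X]add0r; apply: cvgD; last exact: cvgU.
by move=> V V0; apply: Uoo; exact: (favg_shift_cvg g folF fb).
Qed.

End Folner.

(** * From recurrence on average to the set B *)

Section Recurrence.
Local Open Scope ring_scope.
Context {R : realType} {G : groupType}.
Implicit Types (f u v w h : G -> R) (g q x t : G) (F : nat -> set G) (A B C : set G).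

Lemma unit_indic A : unit_valued (\1_A : G -> R).
Proof. by move=> x; rewrite indicE; case: (x \in A); rewrite ?ler01 ?lexx. Qed.

Lemma bfun_indic A : bfun (\1_A : G -> R).
Proof. exact/unit_bfun/unit_indic. Qed.

Section Intersectivity.
Variable m : (G -> R) -> R.
Hypothesis mP : invariant_mean m.
Let mu A := m (\1_A : G -> R).

Lemma mu_le A B : A `<=` B -> mu A <= mu B.
Proof.
move=> AB; apply: (mean_le mP); try exact: bfun_indic.
move=> x; rewrite !indicE ler_nat; case: (boolP (x \in A)) => //= xA.
by rewrite (mem_set (AB _ (set_mem xA))).
Qed.

Lemma mu_setD A B : mu (A `\` B) = mu (A `|` B) - mu B.
Proof.
rewrite /mu -(meanB mP); try exact: bfun_indic.
congr m; apply/funext => x; rewrite !indicE in_setD in_setU.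
by case: (x \in A); case: (x \in B); rewrite /= ?subrr ?subr0.
Qed.

Lemma mu_le1 A : mu A <= 1.
Proof.
rewrite -(mean_cst mP 1); apply: (mean_le mP); [exact: bfun_indic | exact: bfun_cst |].
by move=> x; have /andP[] := unit_indic A x.
Qed.

Lemma geometric_sum (b : R) n : \sum_(k < n) b / 2 ^+ k.+1 = b - b / 2 ^+ n.
Proof.
elim: n => [|n IHn]; first by rewrite big_ord0 expr0 divr1 subrr.
rewrite big_ord_recr/= IHn exprS; field; by rewrite ?expf_neq0.
Qed.

(** A mean is only finitely additive, so the sets [T n] are first grouped
    into finite blocks.  The mean of [T k `|` ... `|` T (k + p)] has a supremum
    over [p], which the block [W k] attains up to [b / 2 ^+ k.+1].  A later
    block is contained in such a union starting at [k], so that it exceeds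
    [W k] by at most that error.  The errors add up to less than [b], and the
    last block has mean at least [b]: some point lies in all of the blocks. *)
Lemma intersectivity (T : nat -> set G) (b : R) : 0 < b ->
  (forall n, b <= mu (T n)) ->
  exists p : nat -> nat, forall n, exists t, forall k, (k <= n)%N ->
    exists2 i, (i <= p k)%N & T (k + i)%N t.
Proof.
move=> b0 bT.
pose U k p := [set t | exists2 i, (i <= p)%N & T (k + i)%N t].
pose E k := range (fun p => mu (U k p)).
have supE k : has_sup (E k).
  split; first by exists (mu (U k 0%N)), 0%N.
  by exists 1 => _ [p _ <-]; apply: mu_le1.
have e0 k : 0 < b / 2 ^+ k.+1 by rewrite divr_gt0 ?exprn_gt0.
have /choice[p pP] k : exists p, sup (E k) - b / 2 ^+ k.+1 < mu (U k p).
  by have [_ [p _ <-] ltp] := sup_adherent (e0 k) (supE k); exists p.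
exists p => n; pose W k := U k (p k).
have [//|noT] := pselect (exists t, forall k, (k <= n)%N -> W k t).
exfalso.
have muW k : (k <= n)%N -> mu (W n `\` W k) <= b / 2 ^+ k.+1.
  move=> kn; rewrite mu_setD.
  have : mu (W n `|` W k) <= sup (E k).
    apply: (@le_trans _ _ (mu (U k (n - k + p n + p k)%N))).
      apply: mu_le => t [[i ip Tt]|[i ip Tt]].
        exists (n - k + i)%N; first by rewrite -addnA leq_add2l (leq_trans ip)// leq_addr.
        by rewrite addnA subnKC.
      by exists i => //; rewrite (leq_trans ip)// leq_addl.
    by apply: ub_le_sup; [exact: (supE k).2 | eexists].
  by have := pP k; rewrite -/(W k); lra.
have : mu (W n) <= \sum_(k < n) b / 2 ^+ k.+1.
  apply: (@le_trans _ _ (m (fun t => \sum_(k < n) \1_(W n `\` W k) t))).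
    apply: (mean_le mP); first exact: bfun_indic.
      by apply: bfun_sum => k; apply: bfun_indic.
    move=> t; have [Wnt|nWnt] := pselect (W n t); last first.
      rewrite indicE memNset//; apply: sumr_ge0 => k _.
      by rewrite indicE; case: (t \in _).
    have [k kn nWk] : exists2 k, (k <= n)%N & ~ W k t.
      apply: contrapT => nk; apply: noT; exists t => k kn.
      by apply: contrapT => nWk; apply: nk; exists k.
    have ltkn : (k < n)%N by rewrite ltn_neqAle kn andbT; apply: contra_notN nWk => /eqP->.
    rewrite (bigD1 (Ordinal ltkn))//= !indicE mem_set// mem_set//.
    by rewrite lerDl; apply: sumr_ge0 => j _; rewrite indicE; case: (t \in _).
  rewrite (mean_sum mP); last by move=> k; apply: bfun_indic.
  by apply: ler_sum => k _; apply: muW; apply: ltnW.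
have : mu (T n) <= mu (W n).
  by apply: mu_le => t Tt; exists 0%N; rewrite ?addn0.
have := bT n; have : 0 < b / 2 ^+ n by rewrite divr_gt0 ?exprn_gt0.
by rewrite geometric_sum; lra.
Qed.

End Intersectivity.

(** By the Folner condition the average of [h] along [F] is asymptotically the
    average of each of its translates; the sum of the translates by [K] is
    at least [d] everywhere. *)
Lemma syndetic_favg F h (K : seq G) (d : R) : left_folner R F -> bfun h ->
  0 < d -> (forall g, 0 <= h g) ->
  (forall g, exists2 k, k \in K & d <= h (k * g)%g) ->
  exists2 b : R, 0 < b & \forall n \near \oo, b <= favg (F n) h.
Proof.
move=> folF hb d0 h0 hK; have [finF F0 _] := folF.
have K0 : 0 < (size K)%:R :> R.
  by have [k + _] := hK 1%g; rewrite ltr0n; case: (K).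
exists (d / 2 / (size K)%:R); first by rewrite !divr_gt0.
have lim0 : (fun n => \sum_(k <- K)
    (favg (F n) (ltranslate k^-1%g h) - favg (F n) h)) @ \oo --> (0 : R).
  elim: (K) => [|k L IHL].
    by under eq_fun do rewrite big_nil; apply: cvg_cst.
  under eq_fun do rewrite big_cons.
  by have := cvgD (favg_shift_cvg k^-1%g folF hb) IHL; rewrite addr0; apply.
have d20 : 0 < d / 2 by rewrite divr_gt0.
near=> n.
have : \sum_(k <- K) (favg (F n) (ltranslate k^-1%g h) - favg (F n) h) <= d / 2.
  by near: n; apply: (cvgr_le _ lim0).
rewrite sumrB sum_const_seq -favg_sum ler_pdivrMr//.
have : d <= favg (F n) (fun g => \sum_(k <- K) ltranslate k^-1%g h g).
  rewrite -[X in X <= _](favg_cst d (finF n) (F0 n)); apply: favg_le => g _.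
  have [k kK dk] := hK g; rewrite (big_rem k kK)/=.
  rewrite {1}/ltranslate invgK (le_trans dk)// lerDl; apply: sumr_ge0 => l _.
  exact: h0.
rewrite [(size K)%:R * _]mulrC; lra.
Unshelve. all: by end_near. Qed.

(** In the proof, [X n t] is the proportion of the [g] in [F n] such that [g t]
    and [g^-1 t] are in [A].  For the finitely many [g] in the sets [F n] of a
    block, some [t] in [W k] satisfies both memberships exactly when [g] is in
    [B]; so [B] has in one of these [F n] the density that [t] guarantees. *)
Lemma recurrence_density m F A (K : seq G) (d : R) : invariant_mean m ->
  left_folner R F -> 0 < d ->
  (forall g, exists2 k, k \in K &
     d <= ip m \1_A (ltranslate ((k * g) * (k * g))%g \1_A)) ->
  exists B, (0 < upper_density R F B)%E /\ mulset B B `<=` mulset A (invset A).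
Proof.
move=> mP folF d0 hK; have [finF F0 _] := folF.
have bA : bfun (\1_A : G -> R) by exact: bfun_indic.
(* By invariance of the mean, [h g] is also the mean over [t] of the indicator
   of [g t \in A /\ g^-1 t \in A]; see [hE]. *)
pose h g := ip m \1_A (ltranslate (g * g)%g \1_A).
pose X n t : R := favg (F n) (\1_[set g | A (g * t)%g /\ A (g^-1 * t)%g]).
have X01 n t : 0 <= X n t <= 1.
  rewrite -[X in X <= _ <= _](favg_cst 0 (finF n) (F0 n)).
  rewrite -[X in _ <= _ <= X](favg_cst 1 (finF n) (F0 n)).
  by apply/andP; split; apply: favg_le => g _; have /andP[] := unit_indic
    [set g | A (g * t)%g /\ A (g^-1 * t)%g] g.
have Xb n : bfun (X n) by apply: unit_bfun => t; apply: X01.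
have hE g : h g = m (fun t => \1_[set g | A (g * t)%g /\ A (g^-1 * t)%g] g).
  rewrite /h /ip -(mean_shift mP g^-1%g); last first.
    by apply: bfunM => //; apply: bfun_shift.
  congr m; apply/funext => t; rewrite /ltranslate invgK !indicE -natrM mulnb.
  rewrite invgM mulgA mulgVK; congr (nat_of_bool _)%:R.
  by apply/andP/idP => [[/set_mem ? /set_mem ?]|/set_mem[? ?]];
    [apply/mem_set | split; apply/mem_set].
have mX n : favg (F n) h = m (X n).
  have indb g : bfun (fun t => \1_[set g | A (g * t)%g /\ A (g^-1 * t)%g] g : R).
    by exists 1 => t; rewrite indicE; case: (_ \in _); rewrite ?normr1 ?normr0.
  rewrite /X /favg (meanZ mP); last exact: bfun_sum.
  by rewrite (mean_sum mP)//; under eq_bigr do rewrite hE.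
have h0 g : 0 <= h g.
  apply: (mean_ge0 mP); first by apply: bfunM => //; apply: bfun_shift.
  by move=> x; rewrite mulr_ge0// /ltranslate indicE.
have hb : bfun h.
  exists 1 => g; rewrite ger0_norm// -(mean_cst mP 1); apply: (mean_le mP).
  - by apply: bfunM => //; apply: bfun_shift.
  - exact: bfun_cst.
  - move=> x; rewrite /ltranslate !indicE -natrM mulnb.
    by case: (_ && _).
have [b b0 [n0 _ hbn]] := syndetic_favg folF hb d0 h0 hK.
pose T n := [set t | b / 2 <= X (n0 + n)%N t].
have b20 : 0 < b / 2 by rewrite divr_gt0.
have muT n : b / 2 <= m (\1_(T n) : G -> R).
  have : m (X (n0 + n)%N) <= m (fun t => \1_(T n) t + b / 2).
    apply: (mean_le mP) => //.
      by apply: bfunD; [apply: bfun_indic | apply: bfun_cst].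
    move=> t; rewrite indicE; case: (boolP (t \in T n)) => [_|/negP Tt] /=.
      by have /andP[_ /le_trans] := X01 (n0 + n)%N t; apply; rewrite lerDl ltW.
    rewrite add0r leNgt; apply/negP => ltX; apply: Tt; apply/mem_set.
    exact: ltW.
  rewrite (meanD mP) ?(mean_cst mP)//; [|exact: bfun_indic|exact: bfun_cst].
  by rewrite -mX; have := hbn _ (leq_addr n n0); rewrite /=; lra.
have [p pP] := intersectivity mP b20 muT.
pose W k := [set t | exists2 i, (i <= p k)%N & T (k + i)%N t].
pose V n := [set t | forall k, (k <= n)%N -> W k t].
have properV : ProperFilter (filter_from [set: nat] V).
  apply: filter_from_proper; last by move=> n _; apply: pP.
  apply: filter_from_filter; first by exists 0%N.
  move=> i j _ _; exists (maxn i j) => // t Vt; split=> k kle; apply: Vt.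
    by rewrite leq_max kle.
  by rewrite leq_max kle orbT.
have [U [ultraU subU]] := ultraFilterLemma properV.
have UW k : U (W k).
  by apply: subU; exists k => // t; apply.
pose B := [set g | U [set t | A (g * t)%g /\ A (g^-1 * t)%g]].
exists B; split; last first.
  move=> _ [x Bx [y By <-]].
  have [t [[Axt _] [_ Ayt]]] := filter_ex (filterI Bx By).
  exists (x * t)%g => //; exists (y^-1 * t)^-1%g; first by exists (y^-1 * t)%g.
  by rewrite invgM invgK mulgA mulgK.
apply: lt_le_trans (_ : ((b / 2)%:E <= _)%E); first by rewrite lte_fin.
apply: le_upper_density => k.
(* An ultrafilter contains each of these sets or its complement, so finitely
   many memberships in [B] are read off a single [t]. *)
have agree (s : seq G) : U [set t | {in s, forall g,
    (A (g * t)%g /\ A (g^-1 * t)%g) <-> B g}].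
  elim: s => [|g s IHs]; first by apply: filterE.
  have [Ug|Ug] := in_ultra_setVsetC [set t | A (g * t)%g /\ A (g^-1 * t)%g] ultraU.
    apply: filterS (filterI IHs Ug) => t [st gt] x.
    by rewrite inE => /predU1P[->|/st].
  apply: filterS (filterI IHs Ug) => t [st gt] x.
  rewrite inE => /predU1P[->|/st//]; split=> // Bg.
  by have [? []] := filter_ex (filterI Bg Ug).
pose s := flatten [seq enum_fset (fset_set (F (n0 + (k + i))%N)) | i <- iota 0 (p k).+1].
have [t [[i ip Tt] st]] := filter_ex (filterI (UW k) (agree s)).
exists (n0 + (k + i))%N; first by rewrite addnCA leq_addr.
rewrite -favg_indic//; apply: le_trans Tt _; apply: favg_le => g Fg.
have [+ _] : A (g * t)%g /\ A (g^-1 * t)%g <-> B g.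
  apply: st; apply/flatten_mapP; exists i; rewrite ?mem_iota//.
  by rewrite in_fset_set// inE.
move=> AB; rewrite !indicE ler_nat.
by case: (boolP (g \in [set _ | _])) => //= /set_mem/AB/mem_set ->.
Qed.

End Recurrence.

Theorem corollary1p28 (R : realType) (G : groupType)
    (fgG : finitely_generated G) (nilG : nilpotent_group G)
    (A : set G) (dA : (0 < left_upper_banach_density R A)%E)
    (F : nat -> set G) (folF : left_folner R F) :
  exists B : set G,
    (0 < upper_density R F B)%E /\ mulset B B `<=` mulset A (invset A).
Proof.
have [_ [Phi folPhi <-] dPhi] := ereal_sup_gt dA.
have [m mP mA] := folner_mean folPhi dPhi.
have f01 : unit_valued (\1_A : G -> R)%R by exact: unit_indic.
have [N [T [nN red cov]]] : exists N T,
    [/\ normal_subgroup N, reducible m (\1_A : G -> R)%R N & covered [set: G] T N].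
  apply: (@nilpotent_ind G (fun H => exists N T, [/\ normal_subgroup N,
    reducible m (\1_A : G -> R)%R N & covered H T N])) => //.
    exists [set 1%g], [:: 1%g]; split.
    - exact: trivial_normal.
    - exact: reducible1.
    - by move=> _ ->; exists 1%g; rewrite ?inE// /eqmod mulVg.
  move=> H y nH [N [T [nN red cov]]] yc.
  have [T' cov'] := covered_adjoin fgG nH nN cov yc.
  exists (central_squares N), T'; split=> //.
    exact: central_squares_normal.
  exact: reducible_central_squares.
have [K hK] := square_returns_syndetic mP f01 mA nN red cov.
apply: (recurrence_density mP folF _ hK).
by rewrite divr_gt0 ?exprn_gt0.
Qed.
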